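(* Fix any $\varepsilon\in(0,1)$. There is a randomized Monte Carlo algorithm for the hypergraph unreliability problem which, given an unweighted hypergraph $G$ with $n$ vertices and $m$ hyperedges and a failure probability $p\in(0,1)$, runs in $m^{O(\log n)}$ time and returns an estimator $X$ satisfying $X\in\left[(1-\varepsilon)u_G(p),\,(1+\varepsilon)u_G(p)\right]$ with high probability.
   Context: A hypergraph $G=(V,E)$ consists of a vertex set $V$ and a (multi)set $E$ of hyperedges, each a nonempty subset of $V$. For $F\subseteq E$, $G-F=(V,E\setminus F)$. A hypergraph is disconnected if there is a bipartition of $V$ into two nonempty parts such that every hyperedge is entirely contained in one part. The unreliability $u_G(p)$ is the probability that $G$ becomes disconnected when every hyperedge is deleted independently with probability $p$. The hypergraph unreliability problem asks to estimate $u_G(p)$. ''With high probability'' means with failure probability bounded by an inverse polynomial in $n$. The running time bound is for fixed $\varepsilon$ (the dependence on $\varepsilon$ is polynomial in $1/\varepsilon$ and is suppressed). *)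

(* Defs.v *)
From HB Require Import structures.
From mathcomp Require Import all_boot all_order all_algebra reals.

Set Implicit Arguments.
Unset Strict Implicit.
Unset Printing Implicit Defensive.

Import Order.TTheory GRing.Theory Num.Theory.

Local Open Scope ring_scope.

(* [E] is a type of indices, so parallel hyperedges are allowed. *)
Record hypergraph (V E : finType) := Hypergraph {
  hedge :> E -> {set V};
  hedge_neq0 : forall e, hedge e != set0
}.

Definition hdel (V E : finType) (G : hypergraph V E) (F : {set E}) :
    hypergraph V {e : E | e \notin F} :=
  Hypergraph (fun e : {e : E | e \notin F} => hedge_neq0 G (val e)).

Definition disconnected (V E : finType) (G : hypergraph V E) : bool :=
  [exists S : {set V}, [&& S != set0, ~: S != set0 &
     [forall e, (G e \subset S) || (G e \subset ~: S)]]].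

Definition unreliability (R : realType) (V E : finType) (G : hypergraph V E)
    (p : R) : R :=
  \sum_(F : {set E} | disconnected (hdel G F))
     p ^+ #|F| * (1 - p) ^+ #|~: F|.

(* Algorithms are programs of a randomized real RAM.  The memory consists of
   natural-number arrays and real arrays, named by natural numbers and
   unbounded; a program mentions only finitely many names.  Reals support
   field operations and comparisons, at unit cost and exactly, but no rounding
   to a natural number.  Natural numbers, which serve as addresses, support
   only addition and truncated subtraction: with unit-cost multiplication and
   division of unbounded integers the model would be unreasonably powerful.
   The only constants are natural numbers, so that a program cannot hide
   information in a real constant. *)
Inductive nexpr : Type :=
| NConst of nat
| NGet of nat & nexpr                (* array name, index *)
| NAdd of nexpr & nexpr
| NSub of nexpr & nexpr.

Inductive rexpr : Type :=
| RofN of nexpr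
| RGet of nat & nexpr                (* array name, index *)
| RAdd of rexpr & rexpr
| RSub of rexpr & rexpr
| RMul of rexpr & rexpr
| RDiv of rexpr & rexpr.

Inductive bexpr : Type :=
| NLe of nexpr & nexpr
| RLe of rexpr & rexpr
| BNot of bexpr
| BAnd of bexpr & bexpr.

Inductive cmd : Type :=
| Skip
| NSet of nat & nexpr & nexpr        (* array name, index, value *)
| RSet of nat & nexpr & rexpr        (* array name, index, value *)
| Flip of nat & nexpr & rexpr        (* array name, index, bias *)
| Seq of cmd & cmd
| If of bexpr & cmd & cmd
| While of bexpr & cmd.

Record state (R : realType) := State {
  nmem : nat -> nat -> nat;
  rmem : nat -> nat -> R
}.

Definition upd (T : Type) (f : nat -> nat -> T) (a i : nat) (v : T) :
    nat -> nat -> T :=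
  fun b j => if (b == a) && (j == i) then v else f b j.

Definition nset (R : realType) (s : state R) (a i v : nat) : state R :=
  State (upd (nmem s) a i v) (rmem s).

Definition rset (R : realType) (s : state R) (a i : nat) (v : R) : state R :=
  State (nmem s) (upd (rmem s) a i v).

Fixpoint neval (R : realType) (s : state R) (e : nexpr) : nat :=
  match e with
  | NConst k => k
  | NGet a i => nmem s a (neval s i)
  | NAdd e1 e2 => (neval s e1 + neval s e2)%N
  | NSub e1 e2 => (neval s e1 - neval s e2)%N
  end.

(* Division by zero returns 0. *)
Fixpoint reval (R : realType) (s : state R) (e : rexpr) : R :=
  match e with
  | RofN e => (neval s e)%:R
  | RGet a i => rmem s a (neval s i)
  | RAdd e1 e2 => reval s e1 + reval s e2
  | RSub e1 e2 => reval s e1 - reval s e2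
  | RMul e1 e2 => reval s e1 * reval s e2
  | RDiv e1 e2 => reval s e1 / reval s e2
  end.

Fixpoint beval (R : realType) (s : state R) (b : bexpr) : bool :=
  match b with
  | NLe e1 e2 => (neval s e1 <= neval s e2)%N
  | RLe e1 e2 => reval s e1 <= reval s e2
  | BNot b => ~~ beval s b
  | BAnd b1 b2 => beval s b1 && beval s b2
  end.

Definition clamp01 (R : realType) (q : R) : R := Num.max 0 (Num.min 1 q).

(* Probability that the commands in the list [k], executed in order from [s],
   terminate within [t] steps in a state satisfying [Q].  [Flip a i q] stores
   a fresh independent Bernoulli(q) bit.  Every command and every evaluation of
   a guard counts as one step; the expressions in it have a size bounded by
   the program, so this is unit cost up to a constant factor. *)
Fixpoint prob_halt (R : realType) (Q : state R -> bool) (t : nat)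
    (k : seq cmd) (s : state R) : R :=
  match k, t with
  | [::], _ => (Q s)%:R
  | _ :: _, 0 => 0
  | c :: k', t'.+1 =>
    match c with
    | Skip => prob_halt Q t' k' s
    | NSet a i e => prob_halt Q t' k' (nset s a (neval s i) (neval s e))
    | RSet a i e => prob_halt Q t' k' (rset s a (neval s i) (reval s e))
    | Flip a i e =>
      let q := clamp01 (reval s e) in
      q * prob_halt Q t' k' (nset s a (neval s i) 1%N)
      + (1 - q) * prob_halt Q t' k' (nset s a (neval s i) 0%N)
    | Seq c1 c2 => prob_halt Q t' (c1 :: c2 :: k') s
    | If b c1 c2 => prob_halt Q t' ((if beval s b then c1 else c2) :: k') s
    | While b c1 =>
      prob_halt Q t' (if beval s b then c1 :: While b c1 :: k' else k') s
    end
  end.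

(* [n] and [m] are in cells 0 and 1 of array 0, the m x n incidence matrix of
   [G] is in array 1 in row-major order, and [p] is in cell 0 of the real
   array 0; everything else is 0. *)
Definition input (R : realType) (n m : nat) (G : hypergraph 'I_n 'I_m)
    (p : R) : state R :=
  State
    (fun a i => match a with
      | 0 => nth 0%N [:: n; m] i
      | 1 => nth 0%N [seq nat_of_bool (v \in G e) | e <- enum 'I_m,
                                                     v <- enum 'I_n] i
      | _ => 0%N
      end)
    (fun a i => if (a == 0%N) && (i == 0%N) then p else 0).

Definition output (R : realType) (s : state R) : R := rmem s 0%N 0%N.

(* Probability that [A], run on [(G, p)], halts within [t] steps with an output
   satisfying [Q]. *)
Definition prob_output (R : realType) (A : cmd) (n m : nat)
    (G : hypergraph 'I_n 'I_m) (p : R) (t : nat) (Q : R -> bool) : R :=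
  prob_halt (fun s => Q (output s)) t [:: A] (input G p).

(* m^(C log n).  The [maxn _ 2] only matter for n < 2 or m < 2, where the
   expression m^(C log n) is not meaningful as a time bound (it can be 0 or 1);
   rounding log_2 n up changes it by a factor of at most 2. *)
Definition time_bound (C n m : nat) : nat :=
  (maxn m 2 ^ (C * up_log 2 (maxn n 2)))%N.

(* Main.v *)
Require Import Defs.
From HB Require Import structures.
From mathcomp Require Import all_boot all_order all_algebra reals.
From mathcomp Require Import zify ring lra.

(* Contracting the surviving hyperedges one at a time in a uniformly random
   order, [j] of the [m] hyperedges survive with binomial probability, and [G]
   is disconnected when [j] contractions leave more than one label.  A run of
   the algorithm samples such an order with importance weights: with [k] labels
   left, it contracts [e] with probability proportional to [f(k + 1 - s_e)],
   where [f(k) = k (k - 1)] and [s_e] is the number of labels of [e], and adds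
   up, over the [j] that leave more than one label, the binomial probability
   times the likelihood ratio so far; this is an unbiased estimate of [u].
   If [lam] is the size of a minimum cut then the [s_e] of the hyperedges that
   still join different labels add up to at least [k lam], so that, [f] being
   convex, the sum of the [M] weights is at most [(M - lam) f(k)].  These factors
   telescope and bound the estimate by [f(n) p^lam], while [u >= p^lam].  Hence
   the variance is at most [f(n) u^2], and Chebyshev's inequality applies to the
   mean of [O(n^(c+2) / eps^2)] runs. *)

Set Implicit Arguments.
Unset Strict Implicit.
Unset Printing Implicit Defensive.

Import Order.TTheory GRing.Theory Num.Theory.

Local Open Scope ring_scope.

(** * Lower bounds on success probabilities *)

Section ProbHalt.
Variable R : realType.
Implicit Types (Q : state R -> bool) (s : state R) (k : seq cmd).

Lemma clamp01_itv (q : R) : 0 <= clamp01 q <= 1.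
Proof.
rewrite /clamp01 le_max lexx /= ge_max ler01 /=.
by rewrite ge_min lexx.
Qed.

Lemma clamp01_id (q : R) : 0 <= q <= 1 -> clamp01 q = q.
Proof. by case/andP=> q0 q1; rewrite /clamp01 (min_idPr q1) (max_idPr q0). Qed.

Lemma prob_halt_itv Q t k s : 0 <= prob_halt Q t k s <= 1.
Proof.
elim: t k s => [|t IH] [|c k] s /=; try by rewrite ?ler0n ?lern1 ?leq_b1 ?lexx ?ler01.
case: c => [|a i e|a i e|a i e|c1 c2|b c1 c2|b c] //=.
have /andP[q0 q1] := clamp01_itv (reval s e).
have /andP[a0 a1] := IH k (nset s a (neval s i) 1%N).
have /andP[b0 b1] := IH k (nset s a (neval s i) 0%N).
nra.
Qed.

Lemma prob_halt_mono Q t t' k s :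
  (t <= t')%N -> prob_halt Q t k s <= prob_halt Q t' k s.
Proof.
elim: t t' k s => [|t IH] [|t'] [|c k] s //= le_tt.
  by case/andP: (prob_halt_itv Q t'.+1 (c :: k) s).
case: c => [|a i e|a i e|a i e|c1 c2|b c1 c2|b c] //=; try exact: IH.
have /andP[q0 q1] := clamp01_itv (reval s e).
by apply: lerD; apply: ler_wpM2l; rewrite ?subr_ge0 ?IH.
Qed.

(* [T] bounds the running time of [c] from [s].  Whatever follows [c], if every
   final state [s'] with [Phi s' v'] leads to success with probability at least
   [v'], then [s] does so with probability at least [v]; taking lower bounds
   for the expectations lets the values [v'] carry the probabilistic part. *)
Definition ensures (T : nat) (c : cmd) (s : state R) (v : R)
    (Phi : state R -> R -> Prop) : Prop :=
  forall Q k t,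
    (forall s' v', Phi s' v' -> v' <= prob_halt Q t k s') ->
    v <= prob_halt Q (T + t) (c :: k) s.

Lemma ensures_mono T T' c s v (Phi Psi : state R -> R -> Prop) :
  (T <= T')%N -> (forall s' v', Phi s' v' -> Psi s' v') ->
  ensures T c s v Phi -> ensures T' c s v Psi.
Proof.
move=> leT PhiPsi H Q k t HP.
apply: le_trans (prob_halt_mono _ _ _ (_ : (T + t <= T' + t)%N)); last by lia.
by apply: H => s' v' /PhiPsi; apply: HP.
Qed.

Lemma ensures_time T T' c s v (Phi : state R -> R -> Prop) :
  ensures T c s v Phi -> (T <= T')%N -> ensures T' c s v Phi.
Proof. by move=> H le; apply: ensures_mono le _ H. Qed.

Lemma ensures_post T c s v (Phi Psi : state R -> R -> Prop) :
  ensures T c s v Phi -> (forall s' v', Phi s' v' -> Psi s' v') ->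
  ensures T c s v Psi.
Proof. by move=> H P; apply: ensures_mono (leqnn T) P H. Qed.

Lemma ensures_le T c s v v' (Phi : state R -> R -> Prop) :
  v <= v' -> ensures T c s v' Phi -> ensures T c s v Phi.
Proof. by move=> le H Q k t /H; apply: le_trans. Qed.

Lemma ensures_skip s v (Phi : state R -> R -> Prop) :
  Phi s v -> ensures 1 Skip s v Phi.
Proof. by move=> H Q k t; apply. Qed.

Lemma ensures_nset a i e s v (Phi : state R -> R -> Prop) :
  Phi (nset s a (neval s i) (neval s e)) v -> ensures 1 (NSet a i e) s v Phi.
Proof. by move=> H Q k t; apply. Qed.

Lemma ensures_rset a i e s v (Phi : state R -> R -> Prop) :
  Phi (rset s a (neval s i) (reval s e)) v -> ensures 1 (RSet a i e) s v Phi.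
Proof. by move=> H Q k t; apply. Qed.

(** An outcome of probability 0 carries no obligation; this is how a selected hyperedge is known to
    have positive weight. *)
Lemma ensures_flip a i e s v v1 v0 (Phi : state R -> R -> Prop) :
  0 <= reval s e <= 1 ->
  v = reval s e * v1 + (1 - reval s e) * v0 ->
  (reval s e != 0 -> Phi (nset s a (neval s i) 1%N) v1) ->
  (reval s e != 1 -> Phi (nset s a (neval s i) 0%N) v0) ->
  ensures 1 (Flip a i e) s v Phi.
Proof.
move=> q01 -> H1 H0 Q k t H /=; rewrite clamp01_id //.
have /andP[q0 q1] := q01.
apply: lerD.
  have [->|nz] := eqVneq (reval s e) 0; first by rewrite !mul0r.
  by rewrite ler_wpM2l // H //; apply: H1.
have [->|nz] := eqVneq (reval s e) 1; first by rewrite subrr !mul0r.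
by rewrite ler_wpM2l ?subr_ge0 // H //; apply: H0.
Qed.

Lemma ensures_seq T1 T2 c1 c2 s v (Phi : state R -> R -> Prop) :
  ensures T1 c1 s v (fun s' v' => ensures T2 c2 s' v' Phi) ->
  ensures (T1 + T2).+1 (Seq c1 c2) s v Phi.
Proof.
move=> H Q k t HP.
rewrite -[(T1 + T2).+1]addn1 addnAC addn1 -addnA /=.
by apply: H => s' v'; apply.
Qed.

Lemma ensures_if T1 T2 b c1 c2 s v (Phi : state R -> R -> Prop) :
  (beval s b -> ensures T1 c1 s v Phi) ->
  (~~ beval s b -> ensures T2 c2 s v Phi) ->
  ensures (T1 + T2).+1 (If b c1 c2) s v Phi.
Proof.
move=> H1 H2 Q k t HP; rewrite addSn /=.
case: (boolP (beval s b)) => [/H1|/H2] H.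
  by apply: (ensures_time H (leq_addr _ _)).
by apply: (ensures_time H (leq_addl _ _)).
Qed.

Lemma ensures_while N T (I : nat -> state R -> R -> Prop) b c s v :
  (forall j s v, (j < N)%N -> I j s v -> beval s b /\ ensures T c s v (I j.+1)) ->
  (forall s v, I N s v -> ~~ beval s b) ->
  I 0%N s v -> ensures (N * T.+1).+1 (While b c) s v (I N).
Proof.
move=> Hbody Hexit I0 Q k t HP.
suff: forall d j s v, (j + d = N)%N -> I j s v ->
    v <= prob_halt Q ((d * T.+1).+1 + t) (While b c :: k) s by apply; last exact: I0.
elim=> [|d IH] j s1 v1 jd Ij.
  have jN : j = N by lia.
  by rewrite jN in Ij; rewrite addSn /= (negbTE (Hexit _ _ Ij)) HP.
have [|bT Hb] := Hbody j s1 v1 _ Ij; first by lia.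
have -> : ((d.+1 * T.+1).+1 + t = (T + ((d * T.+1).+1 + t)).+1)%N by lia.
rewrite /= bT.
by apply: Hb => s' v' /IH; apply; lia.
Qed.

End ProbHalt.

(** * Cells and counting loops *)

Definition cell (i : nat) : nexpr := NGet 0 (NConst i).
Definition setc (i : nat) (e : nexpr) : cmd := NSet 0 (NConst i) e.
Definition rcell (i : nat) : rexpr := RGet 0 (NConst i).
Definition rsetc (i : nat) (e : rexpr) : cmd := RSet 0 (NConst i) e.
Definition incr (i : nat) : cmd := setc i (NAdd (cell i) (NConst 1)).
Definition for_ (i : nat) (e : nexpr) (c : cmd) : cmd :=
  Seq (setc i (NConst 0)) (While (BNot (NLe e (cell i))) (Seq c (incr i))).

(** Beyond the [T] steps of the body, an iteration takes the guard, a [Seq] and the increment; the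
    outer [Seq], the initialization and the last guard take 3 more. *)
Lemma ensures_for (R : realType) i e N T (I : nat -> state R -> R -> Prop) c
    s v (Phi : state R -> R -> Prop) :
  (forall j s v, I j s v -> nmem s 0 i = j /\ neval s e = N) ->
  (forall j s v, (j < N)%N -> I j s v ->
     ensures T c s v (fun s' v' => nmem s' 0 i = j /\ I j.+1 (nset s' 0 i j.+1) v')) ->
  (forall s v, I N s v -> Phi s v) ->
  I 0%N (nset s 0 i 0) v -> ensures (N * (T + 3) + 3) (for_ i e c) s v Phi.
Proof.
move=> HN Hbody Hend I0.
apply: (@ensures_mono _ (1 + (N * (T + 1).+2).+1).+1 _ _ _ _ _ Phi); first by lia.
  by move=> s' v'; exact.
apply: ensures_seq; apply: ensures_nset.
apply: ensures_mono (leqnn _) Hend _.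
apply: ensures_while => // [j s1 v1 ltjN Ij|s1 v1 IN].
  have [ij eN] := HN _ _ _ Ij.
  split; first by rewrite /= eN ij -ltnNge.
  apply: ensures_seq; apply: ensures_mono (Hbody _ _ _ ltjN Ij) => // s' v' [e1 IS].
  by apply: ensures_nset; rewrite /= e1 addn1.
have [ij eN] := HN _ _ _ IN.
by rewrite /= eN ij leqnn.
Qed.

(** * Contraction of hyperedges *)

Section Contraction.
Variables (V E : finType) (G : hypergraph V E).
Implicit Types (F S : {set E}) (U : {set V}) (e : E) (L : V -> V).

Definition cut U : {set E} :=
  [set e | ~~ (G e \subset U) && ~~ (G e \subset ~: U)].

Definition splits U F : bool :=
  [&& U != set0, ~: U != set0 & [disjoint F & cut U]].

(** The argument is the set of surviving hyperedges, whereas [hdel] takes the deleted ones. *)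
Definition disc F : bool := [exists U, splits U F].

Lemma disconnected_hdel F : disconnected (hdel G F) = disc (~: F).
Proof.
apply: eq_existsb => U; rewrite /splits.
case: (U != set0) => //=; case: (~: U != set0) => //=.
apply/forallP/idP => [H|].
  rewrite disjoint_subset; apply/subsetP => e; rewrite !inE => eF.
  by have := H (Sub e eF); rewrite /= -negb_or negbK.
move=> /pred0P H [e eF]; have := H e.
by rewrite /= !inE eF /= -negb_or => /negbFE.
Qed.

Lemma unreliabilityE (R : realType) (p : R) :
  unreliability G p =
    \sum_(S | disc S) p ^+ (#|E| - #|S|) * (1 - p) ^+ #|S|.
Proof.
rewrite /unreliability (reindex_inj (inv_inj (@setCK E))) /=.
apply: eq_big => [S|S _]; first by rewrite disconnected_hdel setCK.
by rewrite setCK -(cardsC S) addKn.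
Qed.

Lemma disc_sub F S : F \subset S -> disc S -> disc F.
Proof.
move=> FS /existsP[U /and3P[U0 U1 H]]; apply/existsP; exists U.
by rewrite /splits U0 U1 (disjointWl FS H).
Qed.

Section Rho.
Variables (R : realType) (y : R).

(* In a run with weight [D] that has contracted the hyperedges of [F], the
   expected increase of [x] is [D * rho F].  A set [S] is reached through each of the
   orders in which its remaining hyperedges can be contracted. *)
Definition rho F : R :=
  \sum_(S : {set E} | disc S && (F \subset S))
     y ^+ (#|S| - #|F|) / 'C(#|S|, #|F|)%:R.

Lemma rho_conn F : ~~ disc F -> rho F = 0.
Proof.
move=> nF; rewrite /rho big_pred0 // => S; apply/negP => /andP[dS FS].
by rewrite (disc_sub FS dS) in nF.
Qed.

(** Each [S] properly containing [F] is reached through [#|S| - #|F|] choices of the next hyperedge,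
    and [mul_bin_left] absorbs this number into the binomial coefficient. The case [S = F] gives the
    first term. *)
Lemma rhoE F :
  rho F = (disc F)%:R + y / (#|F|.+1)%:R * \sum_(e | e \notin F) rho (e |: F).
Proof.
have -> : \sum_(e | e \notin F) rho (e |: F) =
    \sum_(S : {set E} | disc S && (F \proper S))
      (#|S| - #|F|)%:R * (y ^+ (#|S| - #|F|.+1) / 'C(#|S|, #|F|.+1)%:R).
  rewrite /rho (exchange_big_dep (fun S => disc S && (F \proper S))) /=; last first.
    move=> e S eF /andP[-> eFS] /=.
    by apply: proper_sub_trans eFS; rewrite properEcard subsetUr cardsU1 eF add1n /=.
  apply: eq_bigr => S /andP[dS FS].
  transitivity (\sum_(e in S :\: F) y ^+ (#|S| - #|F|.+1) / 'C(#|S|, #|F|.+1)%:R).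
    apply: eq_big => [e|e /andP[eF _]].
      by rewrite !inE dS subUset sub1set (proper_sub FS) andbT.
    by rewrite cardsU1 eF add1n /=.
  rewrite sumr_const cardsD (setIidPr (proper_sub FS)).
  by rewrite mulr_natl.
rewrite [LHS](bigID (fun S => S == F)) /=; congr (_ + _).
  case: (boolP (disc F)) => dF /=.
    rewrite (big_pred1 F) => [|S]; first by rewrite subnn binn divr1.
    by rewrite /=; case: (eqVneq S F) => [->|_]; rewrite ?dF ?subxx ?andbF.
  by rewrite big_pred0 // => S; case: (eqVneq S F) => [->|_]; rewrite ?(negbTE dF) ?andbF.
rewrite big_distrr /=; apply: eq_big => [S|S /andP[/andP[dS FS] SF]].
  by rewrite properEneq eq_sym -andbA [(F \subset S) && _]andbC.
have ltFS : (#|F| < #|S|)%N by rewrite proper_card // properEneq eq_sym SF.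
have -> : (#|S| - #|F| = (#|S| - #|F|.+1).+1)%N by lia.
rewrite exprS; set d := (#|S| - #|F|.+1)%N.
have /(congr1 (fun k => k%:R : R)) := mul_bin_left #|S| #|F|.
rewrite (_ : (#|S| - #|F|)%N = d.+1); last by rewrite /d; lia.
rewrite !natrM => Hbin.
have b0 : ('C(#|S|, #|F|)%:R : R) != 0 by rewrite pnatr_eq0 -lt0n bin_gt0 ltnW.
have b1 : ('C(#|S|, #|F|.+1)%:R : R) != 0 by rewrite pnatr_eq0 -lt0n bin_gt0.
have f0 : ((#|F|.+1)%:R : R) != 0 by rewrite pnatr_eq0.
have -> : (d.+1%:R : R) = #|F|.+1%:R * 'C(#|S|, #|F|.+1)%:R / 'C(#|S|, #|F|)%:R.
  by rewrite Hbin mulfK.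
by field; rewrite b0 b1 addrC natr1 f0.
Qed.

End Rho.

(** Each survivor trades a factor [p] for [1 - p], so factoring out [p ^+ #|E|] leaves a power of
    the odds; the binomials in [rho] are 1 at [set0]. *)
Lemma unreliability_rho (R : realType) (p : R) : p != 0 ->
  unreliability G p = p ^+ #|E| * rho ((1 - p) / p) set0.
Proof.
move=> p0; rewrite unreliabilityE /rho big_distrr /=.
apply: eq_big => [S|S _]; first by rewrite sub0set andbT.
rewrite cards0 subn0 bin0 divr1 expr_div_n.
rewrite -{2}(subnK (max_card (mem S))) exprD.
by field; rewrite expf_neq0.
Qed.

(** * Labels of the contracted hypergraph *)

Definition labels L : nat := #|[set L v | v in V]|.
Definition touched L e : nat := #|[set L v | v in G e]|.
Definition contract L e (r : V) : V -> V :=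
  fun v => if L v \in [set L v | v in G e] then r else L v.

(* The fibers of [L] are the vertex sets of the components of [F]. *)
Definition components L F : Prop :=
  (forall e, e \in F -> {in G e &, forall u v, L u = L v}) /\
  (forall U, [disjoint F & cut U] -> forall u v, L u = L v -> (u \in U) = (v \in U)).

Lemma components_id : components id set0.
Proof. by split=> [e|U _ u v ->]; rewrite ?inE. Qed.

Lemma labels_id : labels id = #|V|.
Proof. exact: card_imset (@inj_id V). Qed.

Lemma touched_gt0 L e : (0 < touched L e)%N.
Proof.
by rewrite card_gt0 imset_eq0 hedge_neq0.
Qed.

Lemma touched_le L e : (touched L e <= labels L)%N.
Proof. by apply/subset_leq_card/imsetS/subsetP. Qed.

Lemma labels_contract L e r : r \in [set L v | v in G e] ->
  labels (contract L e r) = (labels L + 1 - touched L e)%N.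
Proof.
move=> rT; rewrite /labels /touched.
set T := [set L v | v in G e] in rT *; set A := [set L v | v in V].
have TA : T \subset A by apply/imsetS/subsetP.
have -> : [set contract L e r v | v in V] = r |: (A :\: T).
  apply/setP => l; apply/imsetP/idP => [[v _ ->]|].
    rewrite /contract -/T !inE; case: ifP => [_|LvT]; first by rewrite eqxx.
    by rewrite LvT imset_f ?orbT.
  rewrite !inE => /orP[/eqP->|/andP[lT /imsetP[v _ lv]]].
    by case/imsetP: (rT) => v _ rv; exists v => //; rewrite /contract -/T -rv rT.
  by exists v => //; rewrite /contract -/T -lv (negbTE lT).
rewrite cardsU1 !inE rT cardsD (setIidPr TA) add1n addn1.
by rewrite subSn // subset_leq_card.
Qed.

(** As [e] avoids [cut U], it lies on one side of [U], and so do all the classes that it meets;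
    merging them keeps every class on one side. *)
Lemma components_contract L F e r : r \in [set L v | v in G e] ->
  components L F -> components (contract L e r) (e |: F).
Proof.
move=> rT [HF HU]; split=> [f|U].
  rewrite !inE => /orP[/eqP->|fF] u v uf vf; rewrite /contract.
    by rewrite !imset_f.
  by rewrite (HF f fF u v).
move=> dU u v.
have dFU := disjointWl (subsetUr [set e] F) dU.
have /negbT eU := disjointFr dU (setU11 e F).
have Le a b : a \in G e -> L b \in [set L v | v in G e] -> (a \in U) = (b \in U).
  move=> ae /imsetP[b' b'e /(HU _ dFU) ->].
  move: eU; rewrite !inE negb_and !negbK => /orP[] /subsetP H.
    by rewrite !H.
  by have := H a ae; have := H b' b'e; rewrite !inE => /negbTE-> /negbTE->.
have [a ae] := set0Pn _ (hedge_neq0 G e).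
rewrite /contract; case: ifPn => uT; case: ifPn => vT.
- by rewrite -(Le a u) // -(Le a v).
- by move=> rv; rewrite -rv rT in vT.
- by move=> ru; rewrite ru rT in uT.
- exact: HU.
Qed.

Lemma components_disc L F : (0 < #|V|)%N -> components L F ->
  disc F = (1 < labels L)%N.
Proof.
move=> V0 [HF HU]; apply/existsP/idP => [[U /and3P[U0 U1 dFU]]|].
  have [u uU] := set0Pn _ U0; have [v] := set0Pn _ U1; rewrite inE => vU.
  rewrite /labels (cardsD1 (L u)) imset_f // add1n ltnS card_gt0.
  apply/set0Pn; exists (L v); rewrite !inE imset_f // andbT.
  by apply: contraNneq vU => /(HU _ dFU) ->.
move=> /card_gt1P[_ [_ [/imsetP[u _ ->] /imsetP[v _ ->] uv]]].
(* One label class against the rest is a bipartition that no hyperedge of [F] crosses. *)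
exists [set w | L w == L u]; apply/and3P; split.
- by apply/set0Pn; exists u; rewrite inE.
- by apply/set0Pn; exists v; rewrite !inE eq_sym.
rewrite disjoint_subset; apply/subsetP => e eF; rewrite !inE negb_and !negbK.
have [a ae] := set0Pn _ (hedge_neq0 G e).
have [au|au] := eqVneq (L a) (L u); apply/orP; [left|right]; apply/subsetP => b be.
  by rewrite inE (HF e eF b a) // au.
by rewrite !inE (HF e eF b a).
Qed.

(** This makes the minimum cut bound applicable to each label class, with all the cut hyperedges
    outside [F]. *)
Lemma components_label L F l : components L F -> (1 < labels L)%N ->
  l \in [set L v | v in V] -> splits [set v | L v == l] F.
Proof.
move=> [HF HU] k1 /imsetP[u _ ->{l}].
apply/and3P; split.
- by apply/set0Pn; exists u; rewrite inE.
- move: k1; rewrite /labels (cardsD1 (L u)) imset_f // add1n ltnS card_gt0.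
  case/set0Pn => l /setD1P[lu /imsetP[v _ lv]].
  by apply/set0Pn; exists v; rewrite !inE -lv.
rewrite disjoint_subset; apply/subsetP => e eF; rewrite !inE negb_and !negbK.
have [a ae] := set0Pn _ (hedge_neq0 G e).
have [au|au] := eqVneq (L a) (L u); apply/orP; [left|right]; apply/subsetP => b be.
  by rewrite inE (HF e eF b a) // au.
by rewrite !inE (HF e eF b a).
Qed.

(** * Minimum cuts and selection weights *)

Definition min_cut (lam : nat) : Prop :=
  forall U, U != set0 -> ~: U != set0 -> (lam <= #|cut U|)%N.

Definition falling2 (k : nat) : nat := (k * k.-1)%N.

(* [k * (falling2 k - falling2 (k + 1 - s)) >= s * falling2 k] for
   [2 <= s <= k], by concavity in [s]. *)
Lemma falling2_contract k s : (0 < s <= k)%N ->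
  (falling2 (k + 1 - s) * k + (if (1 < s)%N then s else 0) * falling2 k
     <= k * falling2 k)%N.
Proof.
case/andP=> s0 sk; rewrite /falling2; case: ifP => s1.
  have [t kt] : exists t, (k = t + s - 1 /\ 0 < t)%N by exists (k + 1 - s)%N; lia.
  case: kt => -> t0.
  have -> : (t + s - 1 + 1 - s = t)%N by lia.
  have [t' ->] : exists t', t = t'.+1 by exists t.-1; lia.
  have [s' ->] : exists s', s = s'.+2 by exists (s.-2); lia.
  have -> : (t'.+1 + s'.+2 - 1 = (t' + s' + 1).+1)%N by lia.
  rewrite /= [X in (_ + X <= _)%N]mulnCA [X in (X + _ <= _)%N]mulnC -mulnDr.
  by rewrite leq_mul2l; nia.
have -> : s = 1%N by lia.
by rewrite addn1 subn1 /= mul0n addn0 mulnC.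
Qed.

(** Double counting of pairs of a label and a hyperedge touching it: the cut around each label has
    at least [lam] hyperedges, all outside [F], and each of them touches a second label. *)
Lemma sum_touched L F lam : components L F -> min_cut lam -> (1 < labels L)%N ->
  (labels L * lam <=
     \sum_(e | e \notin F) if (1 < touched L e)%N then touched L e else 0)%N.
Proof.
move=> HC Hlam k1.
rewrite -big_mkcondr /=.
under eq_bigr => e _ do rewrite /touched -sum1_card.
rewrite (exchange_big_dep (mem [set L v | v in V])) /=; last first.
  by move=> e l _; apply/subsetP/imsetS/subsetP.
rewrite {1}/labels -sum_nat_const.
apply: leq_sum => l lL; rewrite sum1_card.
have /and3P[U0 U1 dFU] := components_label HC k1 lL.
apply: leq_trans (Hlam _ U0 U1) _; apply/subset_leq_card/subsetP => e ecut.
have eF : e \notin F.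
  by apply: contraTN ecut => eF; rewrite (disjointFr dFU eF).
rewrite unfold_in eF /=.
move: ecut; rewrite !inE => /andP[/subsetPn[a ae]]; rewrite inE => al.
move=> /subsetPn[b be]; rewrite !inE negbK => /eqP bl.
have lT : l \in [set L v | v in G e] by rewrite -bl imset_f.
rewrite lT andbT; apply/card_gt1P; exists (L a), l.
by rewrite lT imset_f.
Qed.

(** [falling2_contract] is summed over the hyperedges outside [F] and combined with [sum_touched];
    the factor [labels L], which avoids a division there, is cancelled. *)
Lemma sum_weights L F lam : components L F -> min_cut lam -> (1 < labels L)%N ->
  (\sum_(e | e \notin F) falling2 (labels L + 1 - touched L e)
     + lam * falling2 (labels L) <= (#|E| - #|F|) * falling2 (labels L))%N.
Proof.
move=> HC Hlam k1; have k0 : (0 < labels L)%N by lia.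
rewrite -(leq_pmul2l k0) mulnDr mulnA.
have := sum_touched HC Hlam k1; rewrite -(leq_pmul2r (_ : 0 < falling2 (labels L))%N).
  rewrite -(leq_add2l (labels L * \sum_(e | e \notin F) falling2 (labels L + 1 - touched L e))).
  move/leq_trans; apply.
  rewrite big_distrr big_distrl -big_split /=.
  apply: (@leq_trans (\sum_(e | e \notin F) labels L * falling2 (labels L))).
    apply: leq_sum => e _; rewrite [X in (X + _)%N]mulnC.
    by apply: falling2_contract; rewrite touched_gt0 touched_le.
  rewrite sum_nat_const (_ : #|_| = #|~: F|); last by apply: eq_card => e; rewrite !inE.
  by rewrite cardsCs setCK mulnCA.
by rewrite /falling2 muln_gt0 k0 -subn1 subn_gt0.
Qed.

(** Every set of survivors that avoids one fixed minimum cut leaves the hypergraph disconnected. *)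
Lemma min_cut_disc_count : (1 < #|V|)%N -> exists lam,
  min_cut lam /\ forall j : nat,
    ('C(#|E| - lam, j) <= #|[set S : {set E} | disc S & #|S| == j]|)%N.
Proof.
move=> /card_gt1P[u [v [_ _ uv]]].
pose P U := (U != set0) && (~: U != set0).
have Pu : P [set u].
  apply/andP; split; apply/set0Pn; first by exists u; rewrite inE.
  by exists v; rewrite !inE eq_sym.
case: (arg_minnP (fun U => #|cut U|) Pu) => U /andP[U0 U1] Umin.
exists #|cut U|; split=> [W W0 W1|j]; first by apply: Umin; rewrite /P W0.
have <- : #|~: cut U| = (#|E| - #|cut U|)%N by rewrite cardsCs setCK.
rewrite -cards_draws; apply/subset_leq_card/subsetP => S; rewrite !inE.
move=> /andP[SU ->]; rewrite andbT; apply/existsP; exists U.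
by rewrite /splits U0 U1 disjoints_subset.
Qed.

(** The sets of survivors are grouped by size. For [lam <= #|E|] the left side is [p ^+ lam]; it
    stays expanded because its terms bound a run one contraction at a time. *)
Lemma unreliability_ge (R : realType) (p : R) (lam : nat) : 0 < p < 1 ->
  (forall j : nat,
    ('C(#|E| - lam, j) <= #|[set S : {set E} | disc S & #|S| == j]|)%N) ->
  \sum_(j < #|E|.+1) 'C(#|E| - lam, j)%:R * (p ^+ (#|E| - j) * (1 - p) ^+ j)
    <= unreliability G p.
Proof.
case/andP=> p0 p1 H; rewrite unreliabilityE.
rewrite (partition_big (fun S : {set E} => inord #|S| : 'I_#|E|.+1) xpredT) //=.
apply: ler_sum => j _.
have card_inord (S : {set E}) : (inord #|S| == j) = (#|S| == j).
  by rewrite -val_eqE /= inordK // ltnS max_card.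
under eq_bigl => S do rewrite card_inord.
under eq_bigr => S /andP[_ /eqP->] do [].
rewrite sumr_const -[X in _ <= X]mulr_natl ler_wpM2r //.
  by rewrite mulr_ge0 // exprn_ge0 // ?subr_ge0 ltW.
rewrite ler_nat (leq_trans (H j)) // eq_leq //.
by apply: eq_card => S; rewrite !inE.
Qed.

End Contraction.

(** * The program *)

Local Notation "c1 ;; c2" := (Seq c1 c2) (at level 61, right associativity).

(* Cells of array 0: 0 [n], 1 [m], 2 index of the run, 3 number of contractions
   attempted, 4 hyperedge index [e], 5 vertex index [v], 6 offset [e * n] of the
   row of [e], 7 number of labels of [e], 8 one of these labels, 9 number of
   labels, 10 random bit, 11 offset of the selected hyperedge, 12 its index.
   Array 1: incidence matrix, 2: labels, 3: marks on the labels of [e],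
   4: contracted hyperedges.  Real cells: 0 [p], 1 sum over the runs, 2 estimate
   [x], 3 the term [D] that [x] gains if more than one label is left, that is,
   binomial probability times likelihood ratio, 4 sum of the selection weights,
   5 weight of the selected hyperedge, 6 weight of [e]. *)
Definition mark : cmd :=
  for_ 5 (cell 0) (NSet 3 (cell 5) (NConst 0)) ;;
  setc 7 (NConst 0) ;;
  for_ 5 (cell 0)
    (If (BAnd (NLe (NConst 1) (NGet 1 (NAdd (cell 6) (cell 5))))
              (NLe (NGet 3 (NGet 2 (cell 5))) (NConst 0)))
        (NSet 3 (NGet 2 (cell 5)) (NConst 1) ;; incr 7 ;; setc 8 (NGet 2 (cell 5)))
        Skip).

Definition merged : nexpr := NSub (NAdd (cell 9) (NConst 1)) (cell 7).

(* Reservoir sampling: each hyperedge replaces the selected one with probability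
   its weight over the sum of the weights so far.  As [0 / 0 = 0], hyperedges of
   weight 0 are never selected. *)
Definition select : cmd :=
  rsetc 4 (RofN (NConst 0)) ;; setc 6 (NConst 0) ;;
  for_ 4 (cell 1)
    (If (NLe (NGet 4 (cell 4)) (NConst 0))
       (mark ;;
        rsetc 6 (RMul (RofN merged) (RSub (RofN merged) (RofN (NConst 1)))) ;;
        rsetc 4 (RAdd (rcell 4) (rcell 6)) ;;
        Flip 0 (NConst 10) (RDiv (rcell 6) (rcell 4)) ;;
        If (NLe (NConst 1) (cell 10))
          (setc 12 (cell 4) ;; setc 11 (cell 6) ;; rsetc 5 (rcell 6)) Skip)
       Skip ;;
     setc 6 (NAdd (cell 6) (cell 0))).

(** The marks are recomputed, as the scan has overwritten them. From [i] to [i + 1] survivors the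
    binomial probability gains [(m - i) / (i + 1)] times the odds, and the likelihood ratio gains
    [1 / (m - i)] over the selection probability; [m - i] cancels. *)
Definition contract_selected : cmd :=
  setc 6 (cell 11) ;; mark ;;
  for_ 5 (cell 0)
    (If (NLe (NConst 1) (NGet 3 (NGet 2 (cell 5)))) (NSet 2 (cell 5) (cell 8)) Skip) ;;
  NSet 4 (cell 12) (NConst 1) ;;
  setc 9 merged ;;
  rsetc 3 (RMul (rcell 3)
    (RMul (RDiv (RSub (RofN (NConst 1)) (rcell 0)) (rcell 0))
          (RDiv (rcell 4) (RMul (RofN (NAdd (cell 3) (NConst 1))) (rcell 5))))).

(** The term is added before contracting, so round [i] accounts for [i] survivors. If all weights
    are 0, any further contraction would leave a single label and add nothing. *)
Definition step : cmd :=
  If (NLe (NConst 2) (cell 9)) (rsetc 2 (RAdd (rcell 2) (rcell 3))) Skip ;;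
  select ;;
  If (RLe (rcell 4) (RofN (NConst 0))) (rsetc 3 (RofN (NConst 0))) contract_selected.

(** The second loop also turns [D] into [p ^+ m], the probability that no hyperedge survives;
    [m + 1] rounds cover 0 to [m] survivors. *)
Definition run : cmd :=
  rsetc 2 (RofN (NConst 0)) ;; rsetc 3 (RofN (NConst 1)) ;; setc 9 (cell 0) ;;
  for_ 5 (cell 0) (NSet 2 (cell 5) (cell 5)) ;;
  for_ 4 (cell 1) (NSet 4 (cell 4) (NConst 0) ;; rsetc 3 (RMul (rcell 3) (rcell 0))) ;;
  for_ 3 (NAdd (cell 1) (NConst 1)) step ;;
  rsetc 1 (RAdd (rcell 1) (rcell 2)).

(** The number [K * n ^ d] of runs is a real expression because natural-number expressions cannot
    multiply. *)
Definition runs_expr (K d : nat) : rexpr :=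
  iter d (RMul (RofN (cell 0))) (RofN (NConst K)).

Definition algorithm (K d : nat) : cmd :=
  If (NLe (cell 0) (NConst 1)) (rsetc 0 (RofN (NConst 0)))
    (While (BNot (RLe (runs_expr K d) (RofN (cell 2)))) (run ;; incr 2) ;;
     rsetc 0 (RDiv (rcell 1) (runs_expr K d))).

(** * Frame conditions and indexing *)

Definition agree (T : Type) (P : nat -> nat -> bool) (f g : nat -> nat -> T) : Prop :=
  forall a i, P a i -> f a i = g a i.

Lemma agree_upd (T : Type) P (f g : nat -> nat -> T) a i x :
  ~~ P a i -> agree P f g -> agree P (upd f a i x) g.
Proof.
move=> nP H b j Pbj; rewrite /upd; case: ifP => [/andP[/eqP ba /eqP ji]|_]; last exact: H.
by rewrite -ba -ji Pbj in nP.
Qed.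

Lemma sum_ord_ltS (R : realType) (m j : nat) (f : 'I_m -> R) (jm : (j < m)%N) :
  \sum_(e < m | (e < j.+1)%N) f e = \sum_(e < m | (e < j)%N) f e + f (Ordinal jm).
Proof.
rewrite (bigD1 (Ordinal jm)) //= addrC; congr (_ + _); apply: eq_bigl => e.
by rewrite ltnS ltn_neqAle -val_eqE andbC.
Qed.

Lemma sum_ord_geS (R : realType) (m j : nat) (f : 'I_m -> R) (jm : (j < m)%N) :
  \sum_(e < m | (j <= e)%N) f e = f (Ordinal jm) + \sum_(e < m | (j < e)%N) f e.
Proof.
rewrite (bigD1 (Ordinal jm)) //=; congr (_ + _); apply: eq_bigl => e.
by rewrite ltn_neqAle -val_eqE andbC eq_sym.
Qed.

Lemma falling2E (R : realType) (k : nat) :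
  (falling2 k)%:R = k%:R * (k%:R - 1) :> R.
Proof. by case: k => [|k]; rewrite /falling2 ?mul0r // natrM /= -natr1 addrK. Qed.

Lemma nth_flatten_const (T S : Type) (x0 : T) (y0 : S) (f : S -> seq T) (n i j : nat)
    (s : seq S) :
  (forall x, size (f x) = n) -> (i < size s)%N -> (j < n)%N ->
  nth x0 (flatten (map f s)) (i * n + j) = nth x0 (f (nth y0 s i)) j.
Proof.
move=> fn; elim: s i => [|x s IH] [|i] //= i_s jn.
  by rewrite mul0n nth_cat fn jn.
by rewrite nth_cat fn mulSn ltnNge -addnA leq_addr /= addKn IH.
Qed.

(** * Correctness *)

Section Correctness.
Variables (R : realType) (n m : nat) (G : hypergraph 'I_n 'I_m) (p : R).
Implicit Types (s : state R) (L : 'I_n -> 'I_n) (F : {set 'I_m}) (e : 'I_m).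

Definition instance s : Prop :=
  [/\ nmem s 0 0 = n, nmem s 0 1 = m, rmem s 0 0 = p &
      forall e (v : 'I_n), nmem s 1 (e * n + v)%N = (v \in G e)].

Lemma input_instance : instance (input G p).
Proof.
split=> // e v /=.
rewrite (nth_flatten_const _ e) ?size_enum_ord // => [|x]; last first.
  by rewrite size_map size_enum_ord.
by rewrite (nth_map v) ?size_enum_ord // !nth_ord_enum.
Qed.

Definition labelled L s : Prop := forall v : 'I_n, nmem s 2 v = L v.

Definition mark_frame (a i : nat) : bool :=
  match a with 0 => i \notin [:: 5; 7; 8]%N | 3 => false | _ => true end.

Definition marked L e s s' : Prop :=
  [/\ rmem s' = rmem s,
      agree mark_frame (nmem s') (nmem s),
      nmem s' 0 7 = touched G L e,
      forall l : 'I_n, nmem s' 3 l = (l \in [set L v | v in G e]) &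
      exists2 r, r \in [set L v | v in G e] & nmem s' 0 8 = r].

Lemma mark_correct L e s v :
  instance s -> labelled L s -> nmem s 0 6 = (e * n)%N ->
  ensures (14 * n + 10) mark s v (fun s' v' => v' = v /\ marked L e s s').
Proof.
move=> [n_s m_s p_s G_s] L_s off_s; eapply ensures_time.
eapply ensures_seq, (@ensures_for _ _ _ n _ (fun j s' v' =>
  [/\ nmem s' 0 5 = j, v' = v, rmem s' = rmem s,
      agree mark_frame (nmem s') (nmem s) &
      forall l : nat, (l < j)%N -> nmem s' 3 l = 0%N])).
- by move=> j s' v' [-> _ _ fr _]; rewrite /= fr.
- move=> j s' v' jn [j_s' -> r_s' fr z]; apply: ensures_nset; split=> //.
  split=> // [|l]; first by do 2!apply: agree_upd => //.
  rewrite /= j_s' /upd /= ltnS leq_eqVlt => /orP[/eqP->|/z->]; rewrite ?eqxx //.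
  by case: ifP.
- move=> s1 v1 [_ -> r_s1 fr1 z1].
  eapply ensures_seq, ensures_nset.
  (* The labels of [e] found on the vertices before [j]. *)
  pose T j := [set L u | u in G e & (u < j)%N].
  eapply (@ensures_for _ _ _ n _ (fun j s' v' =>
    [/\ nmem s' 0 5 = j, v' = v, rmem s' = rmem s,
        agree mark_frame (nmem s') (nmem s) &
        [/\ nmem s' 0 7 = #|T j|,
           forall l : 'I_n, nmem s' 3 l = (l \in T j) &
           T j != set0 -> exists2 r, r \in T j & nmem s' 0 8 = r]])).
  + by move=> j s' v' [-> _ _ fr _]; rewrite /= fr.
  + move=> j s' v' jn [j_s' -> r_s' fr [c7 c3 c8]].
    pose u := Ordinal jn.
    have TS : T j.+1 = if u \in G e then L u |: T j else T j.
      apply/setP => l; case: ifP => ue; rewrite ?inE.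
        apply/imsetP/idP => [[w]|/orP[/eqP->|/imsetP[w]]].
        - rewrite inE ltnS leq_eqVlt andb_orr => /orP[/andP[we /eqP wj]|H] ->.
            by rewrite (_ : w = u) ?eqxx //; apply: val_inj.
          by rewrite imset_f ?orbT // inE.
        - by exists u; rewrite // inE ue /=.
        - by rewrite inE => /andP[we wj] ->; exists w; rewrite // inE we ltnS ltnW.
      apply/imsetP/imsetP => -[w]; rewrite inE => /andP[we wj] ->; exists w => //; rewrite inE we /=.
        rewrite ltnS leq_eqVlt in wj; case/orP: wj => // /eqP wj.
        by rewrite (_ : u = w) ?we // in ue; apply: val_inj.
      exact: ltnW.
    have Lj : nmem s' 2 j = L u by rewrite fr //; exact: (L_s u).
    have Gj : nmem s' 1 (nmem s' 0 6 + j)%N = (u \in G e) by rewrite !fr // off_s -G_s.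
    eapply ensures_if; rewrite [beval _ _]/= j_s' Gj Lj c3.
      rewrite lt0n eqb0 negbK leqn0 eqb0 => /andP[ue uT].
      rewrite ue in TS.
      do 2!eapply ensures_seq, ensures_nset; eapply ensures_nset => /=.
      split=> //; split=> //.
      * by do 4!apply: agree_upd => //.
      * rewrite /upd /= j_s' !Lj; split=> [|l|_].
        - by rewrite TS cardsU1 uT c7 addnC.
        - by rewrite c3 TS !inE -(inj_eq val_inj); case: eqP.
        - by exists (L u); rewrite // TS setU11.
    move=> H; apply: ensures_skip; split=> //.
    have TS' : T j.+1 = T j.
      rewrite TS; case: ifP => // ue; apply/setUidPr; rewrite sub1set.
      by move: H; rewrite ue leqn0 eqb0 negbK.
    split=> //; last by rewrite TS'.
    by apply: agree_upd.
  + move=> s' v' [_ -> r_s' fr [c7 c3 c8]]; split=> //.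
    have TE : T n = [set L u | u in G e].
      apply/setP => l; apply/imsetP/imsetP => -[w we ->]; exists w => //.
        by move: we; rewrite inE ltn_ord andbT.
      by rewrite inE we ltn_ord.
    rewrite TE in c7 c3 c8; split=> //; apply: c8.
    by rewrite -card_gt0 (touched_gt0 G L e).
  + split=> //.
    * by do 2!apply: agree_upd => //.
    * have T0 : T 0%N = set0 by apply/setP => l; rewrite inE; apply/imsetP => -[w]; rewrite inE ltn0 andbF.
      by rewrite T0; split=> [|l|]; rewrite ?cards0 ?inE ?eqxx //=; rewrite /upd /= z1.
- by split=> //; apply: agree_upd.
- by rewrite /=; lia.
Qed.

(** * Selection and contraction of a hyperedge *)

Definition represents L F s : Prop :=
  [/\ instance s, labelled L s, forall e, nmem s 4 e = (e \in F) &
      nmem s 0 9 = labels L].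

Definition stable (a i : nat) : bool :=
  match a with 0 => i \in [:: 0; 1; 2; 3; 9]%N | 1 | 2 | 4 => true | _ => false end.

Definition rstable (a i : nat) : bool := (a == 0%N) && (i < 4)%N.

Lemma represents_agree L F s s' :
  agree stable (nmem s') (nmem s) -> agree rstable (rmem s') (rmem s) ->
  represents L F s -> represents L F s'.
Proof.
move=> an ar [[n_s m_s p_s G_s] L_s F_s k_s].
split=> [|v|e|]; rewrite ?an ?F_s ?k_s //; first split; rewrite ?an ?ar // => e v.
by rewrite an.
Qed.

Definition weight L F e : R :=
  if e \in F then 0 else (falling2 (labels L + 1 - touched G L e))%:R.

Lemma weight_ge0 L F e : 0 <= weight L F e.
Proof. by rewrite /weight; case: ifP. Qed.

(** [g e] stands for the value of continuing with [e] selected, and [v0] for that of continuing with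
    no selection. *)
Lemma select_correct L F (g : 'I_m -> R) v0 s : represents L F s ->
  let S := \sum_e weight L F e in
  ensures (m * (14 * n + 40) + 20) select s
    (if S == 0 then v0 else (\sum_e weight L F e * g e) / S)
    (fun s' v' => [/\ agree stable (nmem s') (nmem s),
       agree rstable (rmem s') (rmem s), rmem s' 0 4 = S &
       if S == 0 then v' = v0 else exists e, [/\ 0 < weight L F e,
         nmem s' 0 12 = e, nmem s' 0 11 = (e * n)%N, rmem s' 0 5 = weight L F e &
         v' = g e]]).
Proof.
move=> rep_s S; set W := weight L F.
have W0 e : 0 <= W e by exact: weight_ge0.
pose Sj j := \sum_(e < m | (e < j)%N) W e.
have Sj0 j : 0 <= Sj j by apply: sumr_ge0 => e _; apply: W0.
pose rest j := \sum_(e < m | (j <= e)%N) W e * g e.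
(* The expectation of [g] at the final selection when the current one has [g] equal to [x]: it is
   kept with probability [Sj j / S]. *)
pose value j x := if S == 0 then v0 else (Sj j * x + rest j) / S.
eapply ensures_time.
eapply ensures_seq, ensures_rset, ensures_seq, ensures_nset.
eapply (@ensures_for _ _ _ m _ (fun j s' v' =>
  [/\ nmem s' 0 4 = j, nmem s' 0 6 = (j * n)%N,
     agree stable (nmem s') (nmem s), agree rstable (rmem s') (rmem s) &
     rmem s' 0 4 = Sj j /\ exists2 x, v' = value j x &
       Sj j != 0 -> exists e, [/\ 0 < W e,
         nmem s' 0 12 = e, nmem s' 0 11 = (e * n)%N, rmem s' 0 5 = W e &
         x = g e]])).
- move=> j s' v' [-> _ an _ _]; split=> //=.
  by have [[_ m_s _ _] _ _ _] := rep_s; rewrite an.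
- move=> j s1 v1 jm [e_s off_s an ar [S_s [x -> sel]]].
  have rep1 := represents_agree an ar rep_s.
  have [[n_s1 m_s1 p_s1 G_s1] L_s1 F_s1 k_s1] := rep1.
  pose f := Ordinal jm.
  have SS : Sj j.+1 = Sj j + W f by exact: sum_ord_ltS.
  have RS : rest j = W f * g f + rest j.+1 by exact: (sum_ord_geS (fun e => W e * g e)).
  have SS0 : S != 0 -> Sj j.+1 = 0 -> W f = 0.
    by move=> _; rewrite SS => /eqP; rewrite paddr_eq0 // => /andP[_ /eqP].
  have off' : (j * n + n = j.+1 * n)%N by rewrite mulSn addnC.
  have F_j : nmem s1 4 j = (f \in F) by rewrite -F_s1.
  eapply ensures_seq, ensures_if.
  + rewrite /= e_s F_j leqn0 eqb0 => fF.
    have Wf : W f = (falling2 (labels L + 1 - touched G L f))%:R.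
      by rewrite /W /weight (negbTE fF).
    eapply ensures_seq, ensures_post.
      by apply: (@mark_correct L f).
    move=> s2 _ [-> [r_s2 an2 c7 _ _]].
    eapply ensures_seq, ensures_rset, ensures_seq, ensures_rset, ensures_seq.
    have w_e : reval s2 (RMul (RofN merged) (RSub (RofN merged) (RofN (NConst 1)))) = W f.
      by rewrite /= c7 an2 // k_s1 Wf falling2E.
    rewrite w_e; set s4 := rset _ _ _ _.
    have r4 : rmem s4 0 4 = Sj j.+1 by rewrite /= /upd /= r_s2 S_s SS.
    have r6 : rmem s4 0 6 = W f by [].
    have r5_4 : rmem s4 0 5 = rmem s1 0 5 by rewrite /= /upd /= r_s2.
    have n4 : nmem s4 = nmem s2 by [].
    have an4 : agree stable (nmem s4) (nmem s).
      move=> a i sai; rewrite -(an a i sai) n4; apply: an2.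
      by case: a sai => [|[|[|[|a]]]] //; case: i => [|[|[|[|[|[|[|[|[|i]]]]]]]]].
    have ar4 : agree rstable (rmem s4) (rmem s).
      by do 2!apply: agree_upd => //; rewrite r_s2.
    move: s4 r4 r6 r5_4 n4 an4 ar4 => s4 r4 r6 r5_4 n4 an4 ar4 {w_e}.
    have q_s4 : reval s4 (RDiv (rcell 6) (rcell 4)) = W f / Sj j.+1.
      by rewrite /= r6 r4.
    have le_WS : W f <= Sj j.+1 by rewrite SS lerDr.
    eapply (@ensures_flip _ _ _ _ _ _ (value j.+1 (g f)) (value j.+1 x)).
    * rewrite q_s4 divr_ge0 //=.
      have [->|Sn0] := eqVneq (Sj j.+1) 0; first by rewrite invr0 mulr0.
      by rewrite ler_pdivrMr ?mul1r // lt_def Sn0 /=.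
    * rewrite q_s4 /value; case: eqP => [_|/eqP Sn0]; first by ring.
      rewrite RS; have [Sj'0|Sn0'] := eqVneq (Sj j.+1) 0.
        have Wf0 : W f = 0 by apply/eqP; rewrite eq_le W0 andbT -Sj'0.
        have Sj'' : Sj j = 0 by rewrite -Sj'0 SS Wf0 addr0.
        by rewrite Sj'0 Sj'' Wf0; ring.
      by rewrite SS in Sn0' *; field; rewrite Sn0 Sn0'.
    * rewrite q_s4 => q0.
      have Wf0 : 0 < W f.
        by rewrite lt_def W0 andbT; apply: contraNneq q0 => ->; rewrite mul0r.
      eapply ensures_if => // _; last first.
      do 2!eapply ensures_seq, ensures_nset; eapply ensures_rset, ensures_nset.
      split; first by rewrite /= /upd /= n4 an2.
      have c4 : nmem s4 0 4 = j by rewrite n4 an2.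
      have c6 : nmem s4 0 6 = (j * n)%N by rewrite n4 an2.
      have c0 : nmem s4 0 0 = n by rewrite n4 an2.
      split=> //.
      - by rewrite /= /upd /= c6 c0.
      - by do 5!apply: agree_upd => //.
      - by apply: agree_upd.
      - rewrite /= /upd /= r4; split=> //; exists (g f) => // _; exists f.
        by rewrite c4 c6 r6.
    * rewrite q_s4 => q1.
      (* The first hyperedge of positive weight is selected with probability 1, so on outcome 0
         there was a selection already. *)
      have sel' : Sj j.+1 != 0 -> Sj j != 0.
        move=> Sn0; apply: contraNneq q1 => Sj_0.
        have <- : Sj j.+1 = W f by rewrite SS Sj_0 add0r.
        by rewrite divff.
      eapply ensures_if => // _; eapply ensures_skip, ensures_nset.
      have c4 : nmem s4 0 4 = j by rewrite n4 an2.
      have c6 : nmem s4 0 6 = (j * n)%N by rewrite n4 an2.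
      have c0 : nmem s4 0 0 = n by rewrite n4 an2.
      split; first by rewrite /= /upd /= c4.
      split=> //.
      - by rewrite /= /upd /= c6 c0.
      - by do 3!apply: agree_upd => //.
      - rewrite /= /upd /= r4; split=> //; exists x => // /sel' /sel [e [We e12 e11 r5 xe]].
        by exists e; rewrite n4 !an2 // r5_4.
  + rewrite /= e_s F_j leqn0 eqb0 negbK => fF.
    have Wf : W f = 0 by rewrite /W /weight fF.
    have SjS : Sj j.+1 = Sj j by rewrite SS Wf addr0.
    eapply ensures_skip, ensures_nset; split; first by [].
    split=> //.
    * by rewrite /= /upd /= off_s n_s1.
    * by apply: agree_upd; first by []; apply: agree_upd.
    * rewrite SjS; split=> //; exists x => //.
      by rewrite /value SjS RS Wf mul0r add0r.
- move=> s' v' [_ _ an ar [S_s [x -> sel]]].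
  have SjS : Sj m = S by apply: eq_bigl => e; rewrite ltn_ord.
  have rm0 : rest m = 0 by rewrite /rest big_pred0 // => e; rewrite leqNgt ltn_ord.
  split=> //; first by rewrite S_s SjS.
  rewrite /value SjS rm0 addr0 in sel *.
  case: eqP => // /eqP Sn0; have [e [We e12 e11 r5 ->]] := sel Sn0.
  by exists e; rewrite mulrC mulKf.
- have Sj00 : Sj 0%N = 0 by rewrite /Sj big_pred0.
  split; [by []| by [] | by do 2!apply: agree_upd => // | by apply: agree_upd |].
  split; first by rewrite Sj00.
  (* Before any selection [x] has coefficient 0, so its value is immaterial. *)
  by exists 0; rewrite ?Sj00 ?eqxx // /value Sj00 mul0r add0r.
- by rewrite /=; nia.
Qed.

Lemma contract_correct L F e s v :
  represents L F s -> nmem s 0 12 = e -> nmem s 0 11 = (e * n)%N ->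
  ensures (20 * n + 30) contract_selected s v (fun s' v' =>
    v' = v /\ exists2 r, r \in [set L u | u in G e] &
    [/\ represents (contract G L e r) (e |: F) s',
       nmem s' 0 2 = nmem s 0 2 /\ nmem s' 0 3 = nmem s 0 3,
       rmem s' 0 1 = rmem s 0 1 /\ rmem s' 0 2 = rmem s 0 2 &
       rmem s' 0 3 = rmem s 0 3 *
         ((1 - p) / p * (rmem s 0 4 / ((nmem s 0 3).+1%:R * rmem s 0 5)))]).
Proof.
move=> [inst_s L_s F_s k_s] c12 c11; eapply ensures_time.
eapply ensures_seq, ensures_nset, ensures_seq, ensures_post.
  by apply: (@mark_correct L e); [exact: inst_s|exact: L_s|exact: c11].
move=> s1 _ [-> [r_s1 an1 c7 c3 [r rT c8]]].
have {}an1 a i : mark_frame a i -> (a, i) != (0, 6)%N -> nmem s1 a i = nmem s a i.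
  by move=> fr ne; rewrite an1 //= /upd; case: a i ne {fr} => [|a] [|[|[|[|[|[|[|i]]]]]]].
have r_s1' : rmem s1 = rmem s by rewrite r_s1.
have [n_s m_s p_s G_s] := inst_s.
(* Vertices before [j] are relabelled and the others still carry [L]; marks belong to labels, so
   they stay valid. *)
eapply ensures_seq, (@ensures_for _ _ _ n _ (fun j s' v' =>
  [/\ nmem s' 0 5 = j, v' = v, rmem s' = rmem s,
     forall a i, mark_frame a i -> a != 2%N -> (a, i) != (0, 6)%N ->
       nmem s' a i = nmem s a i &
     [/\ forall u : 'I_n, nmem s' 2 u = if (u < j)%N then contract G L e r u else L u,
         forall l : 'I_n, nmem s' 3 l = (l \in [set L u | u in G e]),
         nmem s' 0 7 = touched G L e & nmem s' 0 8 = r]])).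
- by move=> j s' v' [-> _ _ an _]; rewrite /= an.
- move=> j s2 v2 jn [j_s -> r_s2 an2 [c2 c3' c7' c8']].
  pose u := Ordinal jn.
  have Lu : nmem s2 2 j = L u by rewrite (c2 u) /= ltnn.
  eapply ensures_if; rewrite [beval _ _]/= j_s Lu c3' lt0n eqb0 negbK => uT.
    apply: ensures_nset; split=> //; split=> //.
      by move=> [|[|[|a]]] [|[|[|[|[|[|i]]]]]] // fr a2 ne; exact: an2.
    split=> // w; rewrite /= /upd /= j_s c8' c2 ltnS.
    case: ltngtP => //= wj; have -> : w = u by apply: val_inj.
    by rewrite /contract uT.
  apply: ensures_skip; split=> //; split=> //.
    by move=> [|[|[|a]]] [|[|[|[|[|[|i]]]]]] // fr a2 ne; exact: an2.
  split=> // w; rewrite /= /upd /= c2 ltnS.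
  case: ltngtP => //= wj; have -> : w = u by apply: val_inj.
  by rewrite /contract (negbTE uT).
- move=> s2 v2 [_ -> r_s2 an2 [c2 c3' c7' c8']].
  eapply ensures_seq, ensures_nset, ensures_seq, ensures_nset, ensures_rset.
  split=> //; exists r => //.
  have c9 : nmem s2 0 9 = labels L by rewrite an2.
  have c12' : nmem s2 0 12 = e by rewrite an2.
  split.
  + split; [split|move=> w|move=> f|].
    * by rewrite /= /upd /= an2.
    * by rewrite /= /upd /= an2.
    * by rewrite /= /upd /= r_s2.
    * by move=> f w; rewrite /= /upd /= an2.
    * by rewrite /= /upd /= c2 ltn_ord.
    * rewrite /= /upd /= c12' an2 // F_s !inE -(inj_eq val_inj).
      by case: eqP.
    * by rewrite /= /upd /= c9 c7' labels_contract.
  + by rewrite /= /upd /= !an2.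
  + by rewrite /= /upd /= r_s2.
  + by rewrite /= /upd /= r_s2 an2 // p_s addn1.
- split=> //; first by move=> a i fr a2 ne; rewrite -an1 //; case: a i fr a2 {ne} => [|[|[|a]]] [|[|[|[|[|[|i]]]]]].
  split=> // w; by rewrite ltn0 [LHS]an1 // L_s.
- by rewrite /=; nia.
Qed.

(** * Expectation and range of a single run *)

Section Analysis.
Hypothesis p01 : 0 < p < 1.
Variable lam : nat.
Hypothesis lam_cut : min_cut G lam.

Local Notation y := ((1 - p) / p).
Local Notation rho := (rho G y).

(** Weight 0 means that contracting [e] leaves a single label. So never selecting such hyperedges
    introduces no bias. *)
Lemma weight_eq0_rho L F e : components G L F -> e \notin F ->
  weight L F e = 0 -> rho (e |: F) = 0.
Proof.
move=> HC eF; rewrite /weight (negbTE eF) => /eqP; rewrite pnatr_eq0 => /eqP W0.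
have [a ae] := set0Pn _ (hedge_neq0 G e).
have rT : L a \in [set L u | u in G e] by rewrite imset_f.
apply: rho_conn; rewrite (components_disc _ (components_contract rT HC)); last first.
  by rewrite card_ord (leq_ltn_trans _ (ltn_ord a)).
by rewrite labels_contract //; case: (_ - _)%N W0 => [|[|k]].
Qed.

(** Unbiasedness of one selection: the probability [weight / S] cancels the factor [S / weight] by
    which [D] is multiplied. *)
Lemma select_value L F i (D al be : R) : components G L F ->
  let S := \sum_e weight L F e in
  al + be * (D * (y / i.+1%:R * \sum_(e | e \notin F) rho (e |: F))) =
  if S == 0 then al else (\sum_e weight L F e *
    (al + be * (D * (y * (S / (i.+1%:R * weight L F e))) * rho (e |: F)))) / S.
Proof.
move=> HC S; case: eqP => [S0|/eqP Sn0].
  rewrite big1 ?mulr0 ?addr0 // => e eF; apply: weight_eq0_rho HC eF _.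
  by move/eqP: S0; rewrite psumr_eq0 => [/allP/(_ e (mem_index_enum e))/eqP|f _ //]; last exact: weight_ge0.
have -> : \sum_e weight L F e * (al + be * (D * (y * (S / (i.+1%:R * weight L F e))) *
      rho (e |: F))) = S * al + \sum_e weight L F e *
    (be * (D * (y * (S / (i.+1%:R * weight L F e))) * rho (e |: F))).
  by rewrite mulr_suml -big_split; apply: eq_bigr => e _; rewrite mulrDr.
rewrite [(_ + _) / S]mulrDl [S * al]mulrC mulfK //; congr (_ + _).
rewrite [in RHS](bigID (fun e => e \in F)) /= [X in (X + _) / S]big1 => [|e eF]; last first.
  by rewrite /weight eF mul0r.
rewrite add0r big_distrr big_distrr big_distrr big_distrl /=; apply: eq_bigr => e eF.
have [W0|W0] := eqVneq (weight L F e) 0.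
  by rewrite (weight_eq0_rho HC eF W0); ring.
field; rewrite W0 Sn0 addrC natr1 pnatr_eq0 /=.
by case/andP: p01 => p0 _; rewrite gt_eqF.
Qed.

(* The terms of the binomial expansion of [p ^+ lam * (p + (1 - p)) ^+ (m - lam)]. *)
Definition mass (j : nat) : R := 'C(m - lam, j)%:R * (p ^+ (m - j) * (1 - p) ^+ j).

Lemma mass_ge0 j : 0 <= mass j.
Proof.
case/andP: p01 => p0 p1.
by rewrite /mass mulr_ge0 // mulr_ge0 // exprn_ge0 // ?subr_ge0 ltW.
Qed.

(** The new [falling2] is the weight of [e] and cancels the denominator. [sum_weights] bounds what
    remains, and its factor [m - lam - #|F|] turns [mass #|F|] into [mass #|F|.+1]. *)
Lemma mass_step L F e (D K : R) : components G L F -> 0 <= D ->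
  D * (falling2 (labels L))%:R <= K * mass #|F| -> 0 < weight L F e ->
  D * (y * ((\sum_e weight L F e) / (#|F|.+1%:R * weight L F e))) *
    (falling2 (labels L + 1 - touched G L e))%:R <= K * mass #|F|.+1.
Proof.
case/andP: p01 => p0 p1 HC D0 HD We.
have eF : e \notin F by apply: contraTN We => eF; rewrite /weight eF ltxx.
have Fm : (#|F| < m)%N.
  rewrite -[X in (_ < X)%N]card_ord -cardsT proper_card // properE subsetT /=.
  by apply/subsetPn; exists e.
have k1 : (1 < labels L)%N.
  have := touched_le G L e; have := touched_gt0 G L e.
  by move: We; rewrite /weight (negbTE eF) ltr0n /falling2; nia.
have := sum_weights HC lam_cut k1; rewrite card_ord => HS.
have {HS} : (\sum_(f | f \notin F) falling2 (labels L + 1 - touched G L f)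
   <= (m - lam - #|F|) * falling2 (labels L))%N.
  by rewrite subnAC mulnBl -[X in (X <= _)%N](addnK (lam * falling2 (labels L))%N) leq_sub2r.
rewrite -(ler_nat R) natr_sum natrM.
have -> : \sum_(f | f \notin F) (falling2 (labels L + 1 - touched G L f))%:R =
    \sum_f weight L F f.
  by rewrite [LHS]big_mkcond; apply: eq_bigr => f _; rewrite /weight; case: (f \in F).
move: (\sum_f _) => S HS.
have -> : (falling2 (labels L + 1 - touched G L e))%:R = weight L F e.
  by rewrite /weight (negbTE eF).
have -> : D * (y * (S / (#|F|.+1%:R * weight L F e))) * weight L F e =
    D * S * (y / #|F|.+1%:R).
  by field; rewrite !gt_eqF // addrC natr1 ltr0n.
have y0 : 0 <= y / #|F|.+1%:R by rewrite !divr_ge0 // ?subr_ge0 ltW.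
apply: le_trans (_ : (K * mass #|F| * (m - lam - #|F|)%:R) * (y / #|F|.+1%:R) <= _).
  rewrite ler_wpM2r //.
  apply: le_trans (_ : D * ((m - lam - #|F|)%:R * (falling2 (labels L))%:R) <= _).
    by rewrite ler_wpM2l.
  by rewrite mulrCA mulrC ler_wpM2r.
rewrite /mass.
have /(congr1 (fun k => k%:R : R)) := mul_bin_left (m - lam) #|F|.
rewrite !natrM => Hbin.
have -> : (m - #|F| = (m - #|F|.+1).+1)%N by lia.
rewrite !exprS.
have f0 : (#|F|.+1%:R : R) != 0 by rewrite pnatr_eq0.
have -> : 'C(m - lam, #|F|.+1)%:R = (m - lam - #|F|)%:R * 'C(m - lam, #|F|)%:R / #|F|.+1%:R :> R.
  by rewrite -Hbin mulrC mulKf.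
rewrite le_eqVlt; apply/orP; left; apply/eqP.
by field; rewrite addrC natr1 f0 gt_eqF.
Qed.

Hypothesis n0 : (0 < n)%N.
Local Notation K := ((falling2 n)%:R : R).

Section Run.
Variables (al be a : R) (j : nat).

(* [al + be * X] is the value of a run returning [X]; affine functions suffice,
   since [X ^+ 2 <= K * u * X] once [X <= K * u] is known. *)
Definition run_invariant (i : nat) s (v : R) : Prop :=
  exists L F,
    [/\ represents L F s, components G L F, nmem s 0 3 = i, nmem s 0 2 = j &
        rmem s 0 1 = a] /\
    [/\ 0 <= rmem s 0 2 <= K * \sum_(l < i) mass l, 0 <= rmem s 0 3,
        rmem s 0 3 = 0 \/
          #|F| = i /\ rmem s 0 3 * (falling2 (labels L))%:R <= K * mass i &
        v = al + be * (rmem s 0 2 + rmem s 0 3 * rho F)].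

Definition step_time : nat := (m * (14 * n + 40) + 20 * n + 70)%N.

Lemma step_correct i s v : (i <= m)%N -> run_invariant i s v ->
  ensures step_time step s v
    (fun s' v' => nmem s' 0 3 = i /\ run_invariant i.+1 (nset s' 0 3 i.+1) v').
Proof.
move=> im [L [F [[rep HC c3 c2 r1] [x_itv D0 HD ->]]]].
have [p0 p1] := andP p01.
have discE : disc G F = (1 < labels L)%N by rewrite (components_disc _ HC) ?card_ord.
set x := rmem s 0 2 in x_itv *; set D := rmem s 0 3 in D0 HD *.
have [x0 xK] := andP x_itv.
pose x1 := x + D * (disc G F)%:R.
have M0 : 0 <= mass i by exact: mass_ge0.
have K0 : 0 <= K by [].
have x1_itv : 0 <= x1 <= K * \sum_(l < i.+1) mass l.
  rewrite addr_ge0 ?mulr_ge0 //= big_ord_recr mulrDr lerD //=.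
  case: HD => [->|[_ HD]]; first by rewrite mul0r mulr_ge0.
  (* With two labels or more [falling2] is at least 1, so the term added is at most [K * mass i]. *)
  apply: le_trans HD; rewrite ler_wpM2l // discE; case: ltnP => // k1.
  by rewrite ler1n /falling2 muln_gt0 -ltnS; case: (labels L) k1 => [|[|k]].
have valE : al + be * (x + D * rho F) =
    (al + be * x1) + be * (D * (y / i.+1%:R * \sum_(e | e \notin F) rho (e |: F))).
  (* [rhoE] divides by [#|F|.+1]; this may differ from [i.+1] only when [D] is 0. *)
  rewrite /x1 rhoE; case: HD => [->|[<- _]]; by ring.
rewrite valE (select_value i D _ be HC).
eapply ensures_time.
pose s0_ok s1 := [/\ represents L F s1, nmem s1 0 3 = i, nmem s1 0 2 = j,
  rmem s1 0 1 = a & rmem s1 0 2 = x1 /\ rmem s1 0 3 = D].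
eapply ensures_seq, (@ensures_post _ _ _ _ _ (fun s' v' => s0_ok s' /\ v' = _)).
  have c9 : nmem s 0 9 = labels L by case: rep.
  eapply ensures_if; rewrite [beval _ _]/= c9 => Hk.
    apply: ensures_rset; split; last by reflexivity.
    split=> //; split=> //.
    by rewrite /x1 discE Hk mulr1.
  apply: ensures_skip; split; last by reflexivity.
  by split=> //; split=> //; rewrite /x1 discE (negbTE Hk) mulr0 addr0.
move=> s1 _ [[rep1 c3_1 c2_1 r1_1 [r2_1 r3_1]] ->].
eapply ensures_seq, ensures_post; first apply: (@select_correct L F
  (fun e => al + be * x1 + be * (D * (y * ((\sum_e weight L F e) /
    (i.+1%:R * weight L F e))) * rho (e |: F))) (al + be * x1) _ rep1).
move=> s2 v2 [an ar S_s sel].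
have rep2 := represents_agree an ar rep1.
have c3_2 : nmem s2 0 3 = i by rewrite an.
have c2_2 : nmem s2 0 2 = j by rewrite an.
have r1_2 : rmem s2 0 1 = a by rewrite ar.
have r2_2 : rmem s2 0 2 = x1 by rewrite ar.
have r3_2 : rmem s2 0 3 = D by rewrite ar.
have S0 : 0 <= \sum_e weight L F e by apply: sumr_ge0 => e _; apply: weight_ge0.
eapply ensures_if; rewrite [beval _ _]/= S_s => HS.
  rewrite eq_le HS S0 /= in sel.
  apply: ensures_rset; split=> //; exists L, F; split=> //; split=> //.
  - by rewrite /= /upd /= r2_2.
  - by left.
  - by rewrite /= /upd /= r2_2 sel; ring.
rewrite -ltNge in HS; rewrite gt_eqF // in sel.
have [e [We e12 e11 r5 v2E]] := sel.
eapply ensures_post; first exact: (contract_correct rep2 e12 e11).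
move=> s3 _ [-> [r rT [rep3 [c2_3 c3_3] [r1_3 r2_3] r3_3]]].
rewrite c3_2 in c3_3; rewrite r3_2 S_s c3_2 r5 in r3_3.
have eF : e \notin F by apply: contraTN We => eF; rewrite /weight eF ltxx.
have LcE : labels (contract G L e r) = (labels L + 1 - touched G L e)%N.
  exact: labels_contract.
split=> //; exists (contract G L e r), (e |: F); split; first split=> //.
- exact: components_contract.
- by rewrite /= /upd /= c2_3.
- by rewrite /= r1_3.
split; rewrite [nset _ _ _ _]/nset [rmem _]/= ?r2_3 ?r2_2 ?r3_3 //.
- rewrite mulr_ge0 // mulr_ge0 ?divr_ge0 ?subr_ge0 ?(ltW p0) ?(ltW p1) //.
  by rewrite mulr_ge0 // ltW.
- case: HD => [->|[cF HD]]; first by left; rewrite mul0r.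
  right; split; first by rewrite cardsU1 eF cF.
  rewrite LcE -cF.
  by apply: (mass_step HC) => //; rewrite cF.
- by rewrite v2E; ring.
- by rewrite /step_time; nia.
Qed.

Definition run_time : nat := (m.+1 * (step_time + 3) + 6 * m + 4 * n + 30)%N.

Lemma run_correct s : instance s -> nmem s 0 2 = j -> rmem s 0 1 = a ->
  ensures run_time run s (al + be * unreliability G p)
    (fun s' v' => [/\ instance s', nmem s' 0 2 = j &
       exists2 X, 0 <= X <= K * \sum_(l < m.+1) mass l &
         rmem s' 0 1 = a + X /\ v' = al + be * X]).
Proof.
move=> inst c2 r1; have [p0 p1] := andP p01.
set v := (X in ensures _ _ _ X).
eapply ensures_time.
eapply ensures_seq, ensures_rset, ensures_seq, ensures_rset, ensures_seq, ensures_nset.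
eapply ensures_seq, (@ensures_for _ _ _ n _ (fun i s' v' =>
  [/\ nmem s' 0 5 = i, v' = v,
    [/\ instance s', nmem s' 0 2 = j, rmem s' 0 1 = a,
        rmem s' 0 2 = 0 /\ rmem s' 0 3 = 1 & nmem s' 0 9 = n] &
    forall u, (u < i)%N -> nmem s' 2 u = u])).
- by move=> i s' v' [-> _ [[n_s _ _ _] _ _ _ _] _].
- move=> i s1 _ i_n [c5 -> H L1]; apply: ensures_nset; split=> //; split=> // u.
  by rewrite /= /upd /= c5 ltnS; case: ltngtP => // ui _; exact: L1.
- move=> s1 _ [_ -> H L1].
  eapply ensures_seq, (@ensures_for _ _ _ m _ (fun i s' v' =>
    [/\ nmem s' 0 4 = i, v' = v,
      [/\ instance s', nmem s' 0 2 = j, rmem s' 0 1 = a,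
          rmem s' 0 2 = 0 /\ rmem s' 0 3 = p ^+ i & nmem s' 0 9 = n] /\
      (forall u, (u < n)%N -> nmem s' 2 u = u) &
      forall e, (e < i)%N -> nmem s' 4 e = 0%N])).
  + by move=> i s' v' [-> _ [[[_ m_s _ _] _ _ _ _] _] _].
  + move=> i s2 _ im [c4 -> [[inst2 c2_2 r1_2 [r2_2 r3_2] c9] L2] F2].
    eapply ensures_seq, ensures_nset, ensures_rset; split=> //; split=> //.
      split=> //; split=> //; split=> //.
      by rewrite /= /upd /= r3_2 exprSr; case: inst2 => _ _ -> _.
    by move=> e; rewrite /= /upd /= c4 ltnS; case: ltngtP => // ei _; exact: F2.
  + move=> s2 _ [_ -> [[inst2 c2_2 r1_2 [r2_2 r3_2] c9] L2] F2].
    eapply ensures_seq, (@ensures_for _ _ _ m.+1 _ run_invariant).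
    * move=> i s' v' [L [F [[[[_ m_s _ _] _ _ _] _ c3 _ _] _]]].
      by rewrite /= m_s addn1.
    * by move=> i s' v' im; apply: step_correct.
    * move=> s3 v3 [L [F [[[inst3 _ _ _] HC c3 c2_3 r1_3] [x_itv _ HD ->]]]].
      apply: ensures_rset; split=> //.
      exists (rmem s3 0 2) => //; split; first by rewrite /= /upd /= r1_3.
      (* There are no [m.+1] hyperedges to contract, so [D] is 0 after the last round. *)
      case: HD => [->|[cF _]]; first by rewrite mul0r addr0.
      by have := max_card (mem F); rewrite card_ord cF ltnn.
    * exists id, set0; split.
        split=> //; last exact: components_id.
        split=> // [u|e|]; first exact: L2.
          by rewrite inE; exact: F2.
        by rewrite /= /upd /= c9 labels_id card_ord.
      rewrite /= /upd /= r2_2 r3_2; split.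
      - by rewrite big_ord0 mulr0 lexx.
      - by rewrite exprn_ge0 // ltW.
      - right; rewrite cards0; split=> //.
        rewrite labels_id card_ord mulrC ler_wpM2l //.
        by rewrite /mass bin0 mul1r subn0 expr0 mulr1.
      - by rewrite add0r /v unreliability_rho ?gt_eqF // card_ord.
  + by split=> //; split=> //; case: H => ? ? ? ? ?; split=> //; rewrite expr0.
- split=> //; split=> //; case: inst => n_s ? ? ?; rewrite /= /upd //= n_s.
- by rewrite /run_time /=; nia.
Qed.

End Run.
End Analysis.

(** * The mean of the runs *)

Local Notation u := (unreliability G p).
Local Notation K := ((falling2 n)%:R : R).

Lemma unreliability0 : (n <= 1)%N -> u = 0.
Proof.
move=> n1; rewrite unreliabilityE big_pred0 // => S.
apply/existsP => -[U /and3P[/set0Pn[v vU] /set0Pn[w wU] _]].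
have vw : v = w by apply: ord_inj; have := ltn_ord v; have := ltn_ord w; lia.
by move: wU; rewrite inE -vw vU.
Qed.

Lemma unreliability_gt0 : 0 < p < 1 -> (1 < n)%N -> 0 < u.
Proof.
move=> p01 n1; have [p0 p1] := andP p01.
have [|lam [_ /(unreliability_ge p01)]] := @min_cut_disc_count _ _ G.
  by rewrite card_ord.
apply: lt_le_trans; rewrite big_ord_recl bin0 mul1r subn0 mulr1.
rewrite ltr_pwDl ?exprn_gt0 // sumr_ge0 // => j _.
by rewrite mulr_ge0 // mulr_ge0 // exprn_ge0 // ?subr_ge0 ltW.
Qed.

(** The same minimum cut makes the sum of [mass] both an upper bound for the estimate, up to [K],
    and a lower bound for [u]. *)
Lemma run_bounded (al be a : R) (j : nat) s : 0 < p < 1 -> (1 < n)%N ->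
  instance s -> nmem s 0 2 = j -> rmem s 0 1 = a ->
  ensures run_time run s (al + be * u)
    (fun s' v' => [/\ instance s', nmem s' 0 2 = j &
       exists2 X, 0 <= X <= K * u & rmem s' 0 1 = a + X /\ v' = al + be * X]).
Proof.
move=> p01 n1 inst c2 r1.
have [|lam [cut_lam /(unreliability_ge p01) u_ge]] := @min_cut_disc_count _ _ G.
  by rewrite card_ord.
rewrite card_ord in u_ge.
apply: ensures_post; first exact: (@run_correct p01 lam cut_lam (ltnW n1) al be a j).
move=> s' v' [inst' c2' [X /andP[X0 XK] H]]; split=> //; exists X => //.
by rewrite X0 (le_trans XK) // ler_wpM2l.
Qed.

Variables (E0 d : nat).
Local Notation N := (E0 * n ^ d)%N.

Lemma reval_runs_expr s : nmem s 0 0 = n -> reval s (runs_expr E0 d) = N%:R.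
Proof.
move=> n_s; rewrite mulnC natrM natrX /runs_expr; elim: d => [|k IH] /=.
  by rewrite expr0 mul1r.
by rewrite IH n_s exprS mulrA.
Qed.

Definition algorithm_time : nat := (N * (run_time + 4) + 10)%N.

(** Chebyshev's inequality in the form of a potential: the squared deviation so far plus
    [K * u ^+ 2] for each run to come does not increase in expectation. *)
Lemma algorithm_correct (th : R) : 0 < p < 1 -> (1 < n)%N -> 0 <= th ->
  ensures algorithm_time (algorithm E0 d) (input G p)
    (1 - th * (N%:R * K * u ^+ 2))
    (fun s' v' => exists y, rmem s' 0 0 = y / N%:R /\
       v' <= 1 - th * (y - N%:R * u) ^+ 2).
Proof.
move=> p01 n1 th0; have inst := input_instance.
eapply ensures_time.
eapply (@ensures_if _ 0); rewrite [beval _ _]/= => Hn.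
- by move: n1; rewrite ltnNge Hn.
- eapply ensures_seq, ensures_post.
    eapply (@ensures_while _ N _ (fun j s' v' =>
      [/\ instance s', nmem s' 0 2 = j & v' <= 1 - th *
        ((rmem s' 0 1 - j%:R * u) ^+ 2 + (N%:R - j%:R) * K * u ^+ 2)])).
    + move=> j s1 v1 jN [inst1 c2 v1_le].
      have [n_s _ _ _] := inst1.
      split; first by rewrite [beval _ _]/= reval_runs_expr //= c2 ler_nat -ltnNge.
      move: v1_le; set a := rmem s1 0 1; set dev := a - j%:R * u => v1_le.
      (* [al + be * X] comes from expanding the new squared deviation [(dev + X - u) ^+ 2] with
         [X ^+ 2] replaced by its upper bound [K * u * X]. *)
      pose al := 1 - th * (dev ^+ 2 - 2 * dev * u + u ^+ 2 + (N%:R - j.+1%:R) * K * u ^+ 2).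
      pose be := - th * (2 * dev + (K - 2) * u).
      apply: (@ensures_le _ _ _ _ _ (al + be * u)).
        apply: le_trans v1_le _; rewrite -subr_ge0.
        have -> : al + be * u - (1 - th * (dev ^+ 2 + (N%:R - j%:R) * K * u ^+ 2)) =
          th * u ^+ 2 by rewrite /al /be -natr1; ring.
        by rewrite mulr_ge0 // sqr_ge0.
      eapply ensures_seq, ensures_post; first exact: (@run_bounded al be a j s1).
      move=> s2 v2 [inst2 c2' [X /andP[X0 XK] [r1' ->]]].
      apply: ensures_nset; split=> //=; first by rewrite /upd /= c2' addn1.
      rewrite r1' -subr_ge0.
      set bound := 1 - _; have -> : bound - (al + be * X) = th * (X * (K * u - X)).
        by rewrite /bound /al /be /dev -natr1; ring.
      by rewrite mulr_ge0 // mulr_ge0 // subr_ge0.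
    + move=> s1 v1 [[n_s _ _ _] c2 _].
      by rewrite [beval _ _]/= reval_runs_expr //= c2 lexx.
    + split=> //=; rewrite le_eqVlt; apply/orP; left; apply/eqP; ring.
  move=> s1 v1 [[n_s _ _ _] _ v1_le]; apply: ensures_rset.
  exists (rmem s1 0 1); split; first by rewrite /= reval_runs_expr.
  by move: v1_le; rewrite subrr !mul0r addr0.
- by rewrite /algorithm_time; nia.
Qed.

Lemma algorithm_trivial : (n <= 1)%N ->
  ensures algorithm_time (algorithm E0 d) (input G p) 1
    (fun s' v' => rmem s' 0 0 = 0 /\ v' = 1).
Proof.
move=> n1; apply: (@ensures_time _ (1 + 0).+1); last by rewrite /algorithm_time; lia.
apply: ensures_if; rewrite [beval _ _]/= ?n1 // => _.
exact: ensures_rset.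
Qed.

End Correctness.

(** * Running time and success probability *)

Lemma algorithm_time_bound (E0 d n m : nat) :
  (algorithm_time n m E0 d <= time_bound (E0 + d + 20) n m)%N.
Proof.
set L := up_log 2 (maxn n 2); pose q := maxn 2 (maxn n m).
have q2 : (2 <= q)%N by rewrite leq_maxl.
have qn : (n <= q)%N by rewrite /q; lia.
have qm : (m <= q)%N by rewrite /q; lia.
have L0 : (0 < L)%N by rewrite lt0n up_log_eq0 -!ltnNge /= leq_maxr.
(* As [n <= 2 ^ L], any polynomial in [n] and [m] is at most a power of [maxn m 2] with exponent
   [O(L)]. *)
have qL : (q <= maxn m 2 ^ L)%N.
  have ML : (maxn m 2 <= maxn m 2 ^ L)%N by rewrite -{1}[maxn m 2]expn1 leq_pexp2l // leq_max orbT.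
  have nL : (maxn n 2 <= maxn m 2 ^ L)%N.
    by apply: leq_trans (up_logP _ (ltnSn 1)) _; rewrite leq_exp2r // leq_maxr.
  by rewrite !geq_max; move: ML nL; rewrite !geq_max => /andP[-> ->] /andP[->].
apply: (@leq_trans (q ^ (E0 + d + 20))); last first.
  by rewrite /time_bound mulnC expnM leq_exp2r ?qL //; lia.
have run_q : (run_time n m + 4 <= q ^ 18)%N.
  have step_q : (step_time n m + 3 <= 64 * (q * q))%N by rewrite /step_time; nia.
  apply: (@leq_trans (256 * (q * (q * q)))).
    have : (m.+1 * (step_time n m + 3) <= (2 * q) * (64 * (q * q)))%N.
      by apply: leq_mul => //; lia.
    by rewrite /run_time; nia.
  have -> : (q ^ 18 = q ^ 15 * (q * (q * q)))%N by exact: (expnD q 15 3).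
  by rewrite leq_mul2r (leq_trans (_ : 256 <= 2 ^ 15)%N) ?orbT // leq_exp2r.
have E0_q : (E0 <= q ^ E0)%N by rewrite ltnW // ltn_expl.
have nd_q : (n ^ d <= q ^ d)%N by case: (d) => // d'; rewrite leq_exp2r.
have big : (10 <= q ^ (E0 + d + 18))%N.
  apply: (@leq_trans (2 ^ 18)%N) => //; apply: (@leq_trans (q ^ 18)); first by rewrite leq_exp2r.
  by rewrite leq_pexp2l ?leq_addl // ltnW.
rewrite /algorithm_time.
have : (E0 * n ^ d * (run_time n m + 4) <= q ^ (E0 + d + 18))%N.
  by rewrite !expnD !leq_mul.
move=> time_z; rewrite -[20%N]/(18 + 2)%N addnA expnD.
move: big time_z; set z := (q ^ (E0 + d + 18))%N => big time_z.
have : (z * 4 <= z * q ^ 2)%N by rewrite leq_mul2l (@leq_mul 2 2) ?orbT.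
lia.
Qed.

Theorem theorem1p1 (R : realType) (eps : R) (heps : 0 < eps < 1) (c : nat) :
  exists (A : cmd) (C : nat),
    forall (n m : nat) (G : hypergraph 'I_n 'I_m) (p : R),
      0 < p < 1 ->
      let T := time_bound C n m in
      let u := unreliability G p in
      prob_output A G p T (fun _ => true) = 1 /\
      1 - n%:R ^- c <=
        prob_output A G p T (fun X => (1 - eps) * u <= X <= (1 + eps) * u).
Proof.
have [eps0 _] := andP heps.
(* The failure probability is at most [falling2 n / (eps ^+ 2 * N)] with [N = E0 * n ^ (c + 2)];
   [E0] absorbs [eps ^- 2], and two powers of [n] absorb [falling2 n]. *)
pose E0 := Num.bound (eps ^- 2).
exists (algorithm E0 (c + 2)), (E0 + (c + 2) + 20)%N => n m G p p01 T u.
have lower v (Q : R -> bool) Phi : ensures (algorithm_time n m E0 (c + 2)) (algorithm E0 (c + 2))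
      (input G p) v Phi ->
    (forall s' v', Phi s' v' -> v' <= (Q (output s'))%:R) ->
    v <= prob_output (algorithm E0 (c + 2)) G p T Q.
  move=> H HP; apply: le_trans (H (fun s => Q (output s)) [::] 0%N HP) _.
  by apply: prob_halt_mono; rewrite addn0 algorithm_time_bound.
have le1 Q : prob_output (algorithm E0 (c + 2)) G p T Q <= 1.
  by have /andP[] := prob_halt_itv (fun s => Q (output s)) T
    [:: algorithm E0 (c + 2)] (input G p).
have nc0 : 0 <= n%:R ^- c :> R by rewrite invr_ge0 exprn_ge0.
have [n1|n1] := leqP n 1.
  have H := algorithm_trivial G p E0 (c + 2) n1.
  split; first by apply/eqP; rewrite eq_le le1; apply: lower H _ => s' v' [_ ->].
  apply: le_trans (_ : 1 <= _); first by rewrite lerBlDr lerDl.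
  by apply: lower H _ => s' v' [r0 ->]; rewrite /output r0 /u unreliability0 // !mulr0 lexx.
have u0 : 0 < u by exact: unreliability_gt0.
split.
  apply/eqP; rewrite eq_le le1 /=.
  (* With [th = 0] the bound is 1 whatever the output, which gives termination. *)
  have := lower _ xpredT _ (@algorithm_correct _ _ _ G p E0 (c + 2) _ p01 n1 (lexx 0)).
  by rewrite mul0r subr0; apply=> s' v' [y [_]]; rewrite mul0r subr0.
set N := (E0 * n ^ (c + 2))%N.
have E0_ge : eps ^- 2 <= E0%:R.
  by rewrite ltW // archi_boundP // invr_ge0 exprn_ge0 // ltW.
have n0 : (0 : R) < n%:R by rewrite ltr0n ltnW.
have E00 : (0 : R) < E0%:R by apply: lt_le_trans E0_ge; rewrite invr_gt0 exprn_gt0.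
have N0 : (0 : R) < N%:R by rewrite natrM natrX mulr_gt0 ?exprn_gt0.
(* This makes the penalty reach 1 when the sum is off by [N * eps * u], so outputs outside the
   interval have value at most 0. *)
pose th := (N%:R * eps * u) ^- 2.
have th0 : 0 <= th by rewrite invr_ge0 sqr_ge0.
apply: le_trans (lower _ _ _ (@algorithm_correct _ _ _ G p E0 (c + 2) _ p01 n1 th0) _).
  rewrite lerD2l lerN2 -/u -/N.
  have -> : th * (N%:R * (falling2 n)%:R * u ^+ 2) = (falling2 n)%:R * eps ^- 2 / N%:R.
    by rewrite /th; field; rewrite !gt_eqF.
  rewrite ler_pdivrMr // [X in _ <= _ * X]natrM natrX exprD mulrCA mulKf; last by rewrite expf_neq0 ?gt_eqF.
  rewrite [in X in _ <= X]mulrC ler_pM ?invr_ge0 ?sqr_ge0 //.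
  by rewrite -natrX ler_nat /falling2; nia.
move=> s' v' [y [r0 v'_le]].
rewrite -/u -/N in r0 v'_le *; apply: le_trans v'_le _; rewrite /output r0.
case: (boolP (_ <= _ <= _)) => [_|out] /=.
  by rewrite lerBlDr lerDl mulr_ge0 // sqr_ge0.
rewrite subr_le0 /th mulrC ler_pdivlMr ?mul1r; last by rewrite exprn_gt0 ?mulr_gt0.
have -> : y - N%:R * u = N%:R * (y / N%:R - u) by field; rewrite gt_eqF.
rewrite -mulrA !exprMn ler_wpM2l ?sqr_ge0 // -exprMn.
move: out; set X := y / _; have eu0 : 0 < eps * u by rewrite mulr_gt0.
by rewrite negb_and -!ltNge => /orP[] H; nra.
Qed.
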